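(* Let $G$ be a finite (additive) abelian group with $n=|G|\ge 2$, let $\Gamma=\mathrm{Cay}(G,S)$ be an integral connected simple Cayley graph, and let $d=|S|$. Put $M=\gcd(d-\alpha_x : x\in G)$, which is a positive integer. Then for every vertex $g\in G$, $\Gamma$ is periodic at $g$, and the set $T(g,g)=\{t>0 : |H_{g,g}(t)|=1\}$ of periods of $g$ equals $\left\{\frac{2\pi l}{M} : l=1,2,3,\dots\right\}$.
   Context: For a finite additive abelian group $G$ and a nonempty subset $S\subseteq G$, the Cayley graph $\mathrm{Cay}(G,S)$ has vertex set $G$, with $u,v$ adjacent iff $u-v\in S$. It is simple when $0\notin S$ and $-S=S$, and connected when $S$ generates $G$. Let $A$ be its adjacency matrix and $H(t)=\exp(itA)=(H_{u,v}(t))_{u,v\in G}$ for $t\in\mathbb{R}$, $i=\sqrt{-1}$. $\Gamma$ is called periodic at $u$ with period $t>0$ if $|H_{u,u}(t)|=1$. Fix a decomposition $G=\mathbb{Z}_{n_1}\oplus\cdots\oplus\mathbb{Z}_{n_r}$. For $x=(x_1,\dots,x_r)\in G$, $\chi_x$ is the character $\chi_x(g)=\prod_{s=1}^r \exp(2\pi i x_sg_s/n_s)$ of $G$, and $x\mapsto\chi_x$ is an isomorphism from $G$ to its character group. The eigenvalues of $A$ are the real numbers $\alpha_x=\sum_{g\in S}\chi_x(g)$, $x\in G$. $\Gamma$ is integral if $\alpha_x\in\mathbb{Z}$ for all $x\in G$. *)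

(* Defs.v *)
From HB Require Import structures.
From mathcomp Require Import all_boot all_order all_algebra all_fingroup.
From mathcomp Require Import all_classical all_reals all_analysis.
From mathcomp Require Import complex.

Set Implicit Arguments.
Unset Strict Implicit.
Unset Printing Implicit Defensive.

Import Order.TTheory GRing.Theory Num.Theory.
Import numFieldNormedType.Exports.

Local Open Scope classical_set_scope.
Local Open Scope ring_scope.
Local Open Scope complex_scope.

(* An isomorphism from G onto Z_{n_1} (+) ... (+) Z_{n_r}: cyc_coord g s is the
   representative in {0, ..., n_s - 1} of the s-th component of g. No n_s can
   be 0, since 'I_0 is empty and G is not. *)
Record cyclic_decomposition (G : finZmodType) := CyclicDecomposition {
  cyc_rank : nat;
  cyc_order : 'I_cyc_rank -> nat;
  cyc_coord : G -> {dffun forall s : 'I_cyc_rank, 'I_(cyc_order s)};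
  cyc_coord_bij : bijective cyc_coord;
  cyc_coordD : forall (u v : G) (s : 'I_cyc_rank),
    nat_of_ord (cyc_coord (u + v) s)
      = ((cyc_coord u s + cyc_coord v s) %% cyc_order s)%N
}.

Definition expi (R : realType) (y : R) : R[i] := cos y +i* sin y.

(* The limit is taken for the sup norm on matrices, i.e. entrywise; it exists
   when K is R or R[i] with R : realType. *)
Definition expmx (K : numFieldType) (n : nat) (B : 'M[K]_n) : 'M[K]_n :=
  lim ((fun N : nat => \sum_(0 <= k < N) k`!%:R^-1 *: B ^+ k) @ \oo).

Section Cayley.

Variables (R : realType) (G : finZmodType) (S : {set G}).

Definition cayley_adj : rel G := fun u v => u - v \in S.

Definition cayley_simple : Prop := 0 \notin S /\ -%R @: S = S.

(* <<S>> is the subgroup generated by S for the additive law of G, which is the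
   group law of the finGroupType attached to a finZmodType. *)
Definition cayley_connected : Prop := <<S>>%g = finset.setT.

Definition adjacency_matrix : 'M[R[i]]_#|G| :=
  \matrix_(j, k) (cayley_adj (enum_val j) (enum_val k))%:R.

Definition transition_matrix (t : R) : 'M[R[i]]_#|G| :=
  expmx ((0 +i* t) *: adjacency_matrix).

Definition transition (u v : G) (t : R) : R[i] :=
  transition_matrix t (enum_rank u) (enum_rank v).

Definition periods (u : G) : set R :=
  [set t : R | 0 < t /\ `|transition u u t| = 1].

Definition periodic_at (u : G) : Prop := exists t : R, periods u t.

Variable D : cyclic_decomposition G.

Definition cayley_char (x g : G) : R[i] :=
  \prod_(s < cyc_rank D)
    expi (2 * pi * (cyc_coord D x s)%:R * (cyc_coord D g s)%:R
          / (cyc_order s)%:R).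

Definition cayley_eigenvalue (x : G) : R[i] := \sum_(g in S) cayley_char x g.

Definition cayley_integral : Prop :=
  forall x : G, exists m : int, cayley_eigenvalue x = m%:~R.

(* gcd of the |S| - alpha_x, x in G, when these are all integers: the floor of
   the real part then merely reads such a complex number as an int. *)
Definition eigengap_gcd : nat :=
  \big[gcdn/0%N]_(x : G)
    `|Num.floor (complex.Re (#|S|%:R - cayley_eigenvalue x)%R)|%N.

End Cayley.

(* Main.v *)
(* The characters diagonalise the adjacency matrix, so that
     H_{u,v}(t) = 1/n sum_x chi_x(u - v) exp(i t alpha_x),
   and H_{g,g}(t) is the mean of n unit complex numbers. It has modulus 1 iff
   these all coincide, i.e. iff t (d - alpha_x) lies in 2 pi Z for every x
   (note alpha_0 = d); by Bezout this says that t M lies in 2 pi Z. *)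
Require Import Defs.
From HB Require Import structures.
From mathcomp Require Import all_boot all_order all_algebra all_fingroup.
From mathcomp Require Import all_classical all_reals all_analysis.
From mathcomp Require Import complex ring lra.

Import Order.TTheory GRing.Theory Num.Theory.
Import numFieldNormedType.Exports.

Local Open Scope classical_set_scope.
Local Open Scope ring_scope.

Set Implicit Arguments.
Unset Strict Implicit.
Unset Printing Implicit Defensive.

(** * Entrywise limits of matrices and the matrix exponential *)

Lemma coord_mx_continuous (T : topologicalType) (m n : nat) (M : 'M[T]_(m, n))
    (i : 'I_m) (j : 'I_n) : {for M, continuous (fun N : 'M[T]_(m, n) => N i j)}.
Proof.
(* Neighbourhoods of a matrix contain boxes; the implications make this box constrain entry [(i, j)]
   alone. *)
move=> A MA; exists (fun i' j' => [set a | i' = i -> j' = j -> A a]).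
  move=> i' j'; have [->|ni] := eqVneq i' i; last first.
    by apply: filterS filterT => a _ /eqP; rewrite (negbTE ni).
  have [->|nj] := eqVneq j' j; last first.
    by apply: filterS filterT => a _ _ /eqP; rewrite (negbTE nj).
  by apply: filterS MA => a Aa _ _.
by move=> N /(_ i j) /(_ erefl erefl).
Qed.

Lemma hausdorff_mx (T : topologicalType) (m n : nat) :
  hausdorff_space T -> hausdorff_space 'M[T]_(m, n).
Proof.
move=> hT p q pq; apply/matrixP => i j; apply: hT => A B pA qB.
have [N [NA NB]] := pq _ _ (coord_mx_continuous pA) (coord_mx_continuous qB).
by exists (N i j).
Qed.

Lemma cvg_mx (T : topologicalType) (m n : nat) (I : Type) (F : set_system I)
    (FF : Filter F) (f : I -> 'M[T]_(m, n)) (M : 'M[T]_(m, n)) :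
  (forall i j, f x i j @[x --> F] --> M i j) -> f x @[x --> F] --> M.
Proof.
move=> fM A [P MP PA].
(* There are finitely many entries, so their eventual properties hold simultaneously. *)
have : \forall x \near F, forall ij : 'I_m * 'I_n, P ij.1 ij.2 (f x ij.1 ij.2).
  by apply: filter_forall => ij; exact: fM.
by apply: filterS => x Px; apply: PA => i j; exact: (Px (i, j)).
Qed.

(** Each partial sum of the exponential series becomes, entry by entry, a finite combination of
    scalar partial sums, through which the limit passes. *)
Lemma expmxE (K : numFieldType) (n : nat) (I : finType) (B : 'M[K]_n)
    (i j : 'I_n) (beta e : I -> K) (c : 'I_n -> 'I_n -> I -> K) :
  (forall k i j, (B ^+ k) i j = \sum_x c i j x * beta x ^+ k) ->
  (forall x, \sum_(0 <= k < N) k`!%:R^-1 * beta x ^+ k @[N --> \oo] --> e x) ->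
  expmx B i j = \sum_x c i j x * e x.
Proof.
move=> Bk he.
suff -> : expmx B = \matrix_(i, j) \sum_x c i j x * e x by rewrite mxE.
apply: cvg_lim; first exact/hausdorff_mx/norm_hausdorff.
apply: cvg_mx => i' j'; rewrite mxE.
rewrite (_ : (fun N => _) = fun N => \sum_x
  c i' j' x * \sum_(0 <= k < N) k`!%:R^-1 * beta x ^+ k); last first.
  apply/funext => N; rewrite summxE.
  under [RHS]eq_bigr do rewrite mulr_sumr.
  rewrite exchange_big; apply: eq_bigr => k _.
  rewrite mxE Bk mulr_sumr; apply: eq_bigr => x _.
  by rewrite mulrCA.
apply: cvg_big => [|x _]; first by move=> x; exact: add_continuous.
by apply: cvgMl_tmp; exact: he.
Qed.

Lemma cvg_numFieldP (K : numFieldType) (u : nat -> K) (l : K) :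
  (forall e, 0 < e -> \forall N \near \oo, `|l - u N| < e) -> u @ \oo --> l.
Proof. by move=> h; apply/cvgrPdist_lt. Qed.

(** * Exponentials of imaginary numbers and their power series *)

Section ComplexExponential.
Variable R : realType.
Implicit Types y t : R.

Lemma expi0 : expi (0 : R) = 1.
Proof. by rewrite /expi cos0 sin0. Qed.

Lemma expiD y t : expi (y + t) = expi y * expi t.
Proof.
apply/eqP; rewrite eq_complex /= cosD sinD eqxx /=.
by rewrite addrC.
Qed.

Lemma norm_expi y : `|expi y| = 1.
Proof. by rewrite normc_def /= cos2Dsin2 sqrtr1. Qed.

Lemma expi_eq0 y : (expi y == 0) = false.
Proof. by rewrite -normr_eq0 norm_expi oner_eq0. Qed.

Lemma expiB y t : expi (y - t) = expi y / expi t.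
Proof. by rewrite -[in RHS](subrK t y) [in RHS]expiD mulfK ?expi_eq0. Qed.

Lemma expi_2pi_nat (k : nat) : expi (2 * pi * k%:R : R) = 1.
Proof.
elim: k => [|k IH]; first by rewrite mulr0 expi0.
by rewrite -(natr1 k) mulrDr expiD IH mul1r mulr1 mulr_natl /expi cos2pi sin2pi.
Qed.

Lemma expi_2pi_int (k : int) : expi (2 * pi * k%:~R : R) = 1.
Proof.
case: k => k; first exact: expi_2pi_nat.
by rewrite NegzE mulrNz mulrN -sub0r expiB expi0 expi_2pi_nat divr1.
Qed.

(** Reduce [y] to [r] in [0, 2 pi). If [r] is nonzero then sin(r/2) > 0, which contradicts 1 = cos r
    = 1 - 2 sin^2(r/2). *)
Lemma expi_eq1 y : expi y = 1 -> exists k : int, y = 2 * pi * k%:~R.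
Proof.
have pi2 : 0 < 2 * pi :> R by rewrite mulr_gt0 ?pi_gt0.
set k := Num.floor (y / (2 * pi)) => y1; exists k.
have /andP[] := floor_itv (y / (2 * pi)); rewrite -/k.
rewrite ler_pdivlMr // ltr_pdivrMr // intrD (mulrDl k%:~R) mul1r.
rewrite -subr_ge0 -ltrBlDl.
have : expi (y - 2 * pi * k%:~R) = 1 by rewrite expiB y1 expi_2pi_int divr1.
rewrite [_%:~R * _]mulrC; set r := y - _ => r1 r0 r2.
suff : r / 2 = 0.
  by move/eqP; rewrite mulf_eq0 invr_eq0 pnatr_eq0 orbF subr_eq0 => /eqP.
apply/eqP/contraT => rn0.
have : 0 < sin (r / 2).
  apply: sin_gt0_pi; rewrite lt0r rn0 divr_ge0 //=.
  by rewrite ltr_pdivrMr // mulrC.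
have : cos ((r / 2) *+ 2) = 1.
  by rewrite -mulr_natr divfK ?pnatr_eq0 //; case: r1.
rewrite cos_mulr2n cos2sin2; move: (sin _) => s cs s0.
have := exprn_gt0 2 s0; move: cs; rewrite mulr2n; lra.
Qed.

Lemma expi_coeff y (k : nat) :
  k`!%:R^-1 * (0 +i* y)%C ^+ k = (cos_coeff y k +i* sin_coeff y k)%C.
Proof.
(* Parity decides whether i^k is real or imaginary. At [k = 0] the truncated [k.-1] is harmless, as
   its parity factor vanishes. *)
have pw : (0 +i* y)%C ^+ k = (((~~ odd k)%:R * (-1) ^+ k./2 * y ^+ k)
                        +i* ((odd k)%:R * (-1) ^+ k.-1./2 * y ^+ k))%C.
  elim: k => [|k IH]; first by rewrite /= !expr0 !mul1r !mul0r.
  rewrite exprS IH; apply/eqP; rewrite eq_complex /= uphalf_half !exprS.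
  case: (boolP (odd k)) => ok;
      rewrite /= ?mul0r ?mul1r ?sub0r ?add0r ?addr0 ?mulr0 ?eqxx ?andbT /=.
    case: k ok {IH} => //= k; rewrite uphalf_half => /negbTE ->.
    by rewrite add0n (exprS _ k./2) mulN1r mulNr mulrCA.
  by rewrite oppr0 eqxx mulrCA /=.
rewrite pw -[k`!%:R](rmorph_nat (real_complex R)) -fmorphV.
apply/eqP; rewrite eq_complex /= !mul0r subr0 addr0.
by rewrite ![_^-1 * _]mulrC !eqxx.
Qed.

Lemma norm_complex_le (a b : R) : `|(a +i* b)%C| <= (`|a| + `|b|)%:C%C.
Proof.
rewrite [X in `|X|]complexE (le_trans (ler_normD _ _)) //= rmorphD lerD //.
- by rewrite normc_def /= expr0n addr0 sqrtr_sqr.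
- rewrite normrM !normc_def /= !expr0n add0r addr0 expr1n sqrtr1 mul1r.
  by rewrite sqrtr_sqr.
Qed.

(** The real and imaginary partial sums are the cosine and sine series. The ascription
    [Num.NumField.sort] selects the topology that [expmx] uses. *)
Lemma cvg_expi y :
  \sum_(0 <= k < N) k`!%:R^-1 * (0 +i* y)%C ^+ k @[N --> \oo] -->
    (expi y : Num.NumField.sort R[i]%C).
Proof.
(* A positive [e] of [R[i]] has zero imaginary part; half of its real part is the tolerance for each
   series. *)
apply: cvg_numFieldP => e; rewrite ltcE /= => /andP[/eqP e0 ep].
have hc : series (cos_coeff y) @ \oo --> cos y.
  by rewrite cos.unlock; exact: is_cvg_series_cos_coeff.
have hs : series (sin_coeff y) @ \oo --> sin y.
  by rewrite sin.unlock; exact: is_cvg_series_sin_coeff.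
have ep2 : 0 < complex.Re e / 2 by rewrite divr_gt0.
move/cvgrPdist_lt/(_ _ ep2): hc => hc; move/cvgrPdist_lt/(_ _ ep2): hs => hs.
have serE N : \sum_(0 <= k < N) k`!%:R^-1 * (0 +i* y)%C ^+ k
    = (series (cos_coeff y) N +i* series (sin_coeff y) N)%C.
  rewrite /series /=; elim: N => [|N IH]; first by rewrite !big_nil.
  by rewrite !big_nat_recr //= IH expi_coeff.
near=> N; rewrite serE.
apply: le_lt_trans (norm_complex_le _ _) _.
rewrite ltcE /= e0 eqxx /= [ltRHS]splitr ltrD //; near: N.
- exact: hc.
- exact: hs.
Unshelve. all: by end_near. Qed.

End ComplexExponential.

(** * Characters: additivity, separation of points, orthogonality *)

Section CayleyCharacter.
Variables (R : realType) (G : finZmodType) (D : cyclic_decomposition G).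
Implicit Types x y g u v : G.
Local Notation chi := (cayley_char R D).

Lemma cyc_order_gt0 (s : 'I_(cyc_rank D)) : (0 < cyc_order s)%N.
Proof. exact: leq_ltn_trans (leq0n _) (ltn_ord (cyc_coord D 0 s)). Qed.

(** From 0 + 0 = 0, this coordinate c satisfies c = 2c mod n_s, and c < n_s. *)
Lemma cyc_coord0 (s : 'I_(cyc_rank D)) : cyc_coord D 0 s = 0%N :> nat.
Proof.
have /eqP := cyc_coordD 0 0 s; rewrite addr0.
rewrite -{1}[nat_of_ord _](modn_small (ltn_ord (cyc_coord D 0 s))).
rewrite -{1}[X in X == _ %[mod _]]addn0 eqn_modDl mod0n eq_sym.
by rewrite modn_small // => /eqP.
Qed.

(** The discarded multiple of [n] only shifts the angle by an integer multiple of 2 pi. *)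
Lemma expi_modn (x a n : nat) : (0 < n)%N ->
  expi (2 * pi * x%:R * (a %% n)%:R / n%:R) =
  expi (2 * pi * x%:R * a%:R / n%:R) :> R[i]%C.
Proof.
move=> n0.
rewrite [in RHS](divn_eq a n) (natrD _ (a %/ n * n)) (mulrDr (2 * pi * x%:R)).
rewrite [(_ + _) / _]mulrDl expiD natrM.
rewrite mulrA mulfK ?pnatr_eq0 -?lt0n // -(mulrA (2 * pi) _ (a %/ n)%:R) -natrM.
by rewrite expi_2pi_nat mul1r.
Qed.

Lemma cayley_charC x g : chi x g = chi g x.
Proof.
apply: eq_bigr => s _.
by rewrite -!mulrA; congr (expi (_ * (_ * _))); rewrite mulrCA.
Qed.

Lemma cayley_charDr x u v : chi x (u + v) = chi x u * chi x v.
Proof.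
rewrite /cayley_char -big_split; apply: eq_bigr => s _ /=.
rewrite cyc_coordD expi_modn ?cyc_order_gt0 // (natrD _ (cyc_coord D u s)).
by rewrite (mulrDr (2 * pi * (cyc_coord D x s)%:R)) [(_ + _) / _]mulrDl expiD.
Qed.

Lemma cayley_charDl x y g : chi (x + y) g = chi x g * chi y g.
Proof. by rewrite cayley_charC cayley_charDr !(cayley_charC g). Qed.

Lemma cayley_charr0 x : chi x 0 = 1.
Proof.
by rewrite /cayley_char big1 // => s _; rewrite cyc_coord0 mulr0 mul0r expi0.
Qed.

Lemma cayley_char_separates g : (forall x, chi x g = 1) -> g = 0.
Proof.
move=> chig; have [f fK Kf] := cyc_coord_bij D.
suff g0 s : cyc_coord D g s = 0%N :> nat.
  apply: (can_inj fK); apply/ffunP => s; apply: val_inj.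
  by rewrite /= g0 cyc_coord0.
(* The s-th unit vector; it vanishes when n_s = 1, but then so does g_s. *)
pose d : {dffun forall s : 'I_(cyc_rank D), 'I_(cyc_order s)} :=
  [ffun s' => Ordinal (ltn_pmod (s' == s) (cyc_order_gt0 s'))].
have := chig (f d).
rewrite cayley_charC /cayley_char (bigD1 s) //= big1; last first.
  move=> s' /negbTE ns; rewrite Kf ffunE /= ns mod0n.
  by rewrite mulr0 mul0r expi0.
rewrite Kf ffunE /= expi_modn ?cyc_order_gt0 // eqxx !mulr1 -mulrA.
(* So g_s / n_s is the integer [k], and g_s < n_s leaves only g_s = 0. *)
case/expi_eq1 => k.
have pi2 : 2 * pi != 0 :> R by rewrite mulf_neq0 ?pnatr_eq0 // gt_eqF ?pi_gt0.
move/(mulfI pi2)/(congr1 ( *%R^~ (cyc_order s)%:R)).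
rewrite divfK ?pnatr_eq0 -?lt0n ?cyc_order_gt0 // !pmulrn -intrM.
move/intr_inj/(congr1 absz); rewrite abszM /= => gk.
apply/eqP; rewrite -(modn_small (ltn_ord (cyc_coord D g s))).
by rewrite -/(dvdn _ _) gk dvdn_mull.
Qed.

(** Orthogonality: if [g] is nonzero, some [chi y g] differs from 1, and translating the index by
    [y] multiplies the sum by it. *)
Lemma cayley_char_sum g : \sum_x chi x g = (#|G| * (g == 0))%:R.
Proof.
have [->|g0] := eqVneq g 0.
  by under eq_bigr do rewrite cayley_charr0; rewrite sumr_const muln1.
rewrite muln0; have [y yg] : exists y, chi y g != 1.
  apply: contrapT => h; move/eqP: g0; apply; apply: cayley_char_separates => x.
  by apply/eqP; apply: contrapT => /negP nx; apply: h; exists x.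
apply: (mulfI (x := chi y g - 1)); first by rewrite subr_eq0.
rewrite mulr0 mulrBl mul1r mulr_sumr; apply/eqP; rewrite subr_eq0; apply/eqP.
rewrite [RHS](reindex_inj (addrI y)); apply: eq_bigr => x _.
by rewrite cayley_charDl.
Qed.

End CayleyCharacter.

(** * Spectral decomposition of the adjacency matrix *)

Section CayleyGraph.
Variables (R : realType) (G : finZmodType) (D : cyclic_decomposition G).
Variable S : {set G}.
Hypothesis hsimple : cayley_simple S.
Implicit Types x y g u v : G.
Local Notation chi := (cayley_char R D).
Local Notation alpha := (cayley_eigenvalue R S D).

(** Substituting w = u - s restricts the sum to s in [S]; since -S = S, the values chi_x(-s) add up
    to alpha_x. The translation by [v] provides the columns of the matrix powers. *)
Lemma cayley_eigenvector x u v :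
  \sum_w (cayley_adj S u w)%:R * chi x (w - v) = chi x (u - v) * alpha x.
Proof.
rewrite (reindex_inj (addrI u)) (reindex_inj oppr_inj) mulr_sumr.
rewrite [RHS](reindex_inj oppr_inj) [LHS](bigID (mem S)) /=.
rewrite [X in _ + X]big1 ?addr0; last first.
  by move=> s /negbTE ns; rewrite /cayley_adj opprD opprK addNKr ns mul0r.
have SN s : (- s \in S) = (s \in S).
  by rewrite -[in LHS](hsimple.2) (mem_imset _ _ oppr_inj).
apply: eq_big => [s|s sS]; first by rewrite SN.
by rewrite /cayley_adj opprD opprK addNKr sS mul1r -cayley_charDr addrAC.
Qed.

(** The factor of [alpha x ^+ k] is an entry of the projection onto the line of chi_x. By induction:
    orthogonality gives the identity matrix, the eigenvector relation each further power. *)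
Lemma adjacency_matrixX (k : nat) (i j : 'I_#|G|) :
  (adjacency_matrix R S ^+ k) i j =
  \sum_x #|G|%:R^-1 * chi x (enum_val i - enum_val j) * alpha x ^+ k.
Proof.
have n0 : #|G|%:R != 0 :> R[i]%C.
  by rewrite pnatr_eq0 -lt0n; apply/card_gt0P; exists 0.
elim: k i j => [|k IH] i j.
  under eq_bigr do rewrite mulr1.
  rewrite -mulr_sumr cayley_char_sum natrM mulKf //.
  by rewrite expr0 mxE subr_eq0 (inj_eq enum_val_inj).
rewrite exprS mxE.
under eq_bigr do rewrite IH mulr_sumr.
rewrite exchange_big; apply: eq_bigr => x _ /=.
rewrite exprS mulrA -[_ * _ * alpha x]mulrA -cayley_eigenvector.
rewrite [in RHS](reindex (@enum_val G G)) /=; last first.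
  exact/onW_bij/enum_val_bij.
rewrite mulr_sumr mulr_suml; apply: eq_bigr => l _; rewrite mxE.
by rewrite !mulrA; congr (_ * _ * _); rewrite mulrC.
Qed.

End CayleyGraph.

(** * Transition matrix and the modulus of its diagonal entries *)

Lemma exp_complexM (R : realType) (t a : R) (k : nat) :
  (0 +i* t)%C ^+ k * a%:C%C ^+ k = (0 +i* (t * a))%C ^+ k.
Proof.
rewrite -exprMn; congr (_ ^+ k); apply/eqP.
by rewrite eq_complex /= !mul0r mulr0 subr0 add0r !eqxx.
Qed.

Lemma scalemxX (K : comPzRingType) (n : nat) (c : K) (B : 'M[K]_n) (k : nat) :
  (c *: B) ^+ k = c ^+ k *: B ^+ k.
Proof.
elim: k => [|k IH]; first by rewrite !expr0 scale1r.
by rewrite !exprS IH -[LHS]/(_ *m _) -scalemxAl -scalemxAr scalerA.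
Qed.

Section Transition.
Variables (R : realType) (G : finZmodType) (D : cyclic_decomposition G).
Variable S : {set G}.
Hypothesis hsimple : cayley_simple S.
Variable a : G -> R.
Hypothesis alphaE : forall x, cayley_eigenvalue R S D x = (a x)%:C%C.
Local Notation chi := (cayley_char R D).

(** Eigenvalues enter as reals [a x], so that i t alpha_x is purely imaginary and [cvg_expi]
    applies. *)
Lemma transitionE (u v : G) (t : R) :
  transition S u v t = \sum_x #|G|%:R^-1 * chi x (u - v) * expi (t * a x).
Proof.
rewrite /transition /transition_matrix.
rewrite (@expmxE _ _ _ _ _ _ (fun x => (0 +i* (t * a x))%C)
  (fun x => expi (t * a x))
  (fun i j x => #|G|%:R^-1 * chi x (enum_val i - enum_val j))).
- by rewrite !enum_rankK.
- move=> k i j; rewrite scalemxX mxE (adjacency_matrixX _ D) // mulr_sumr.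
  apply: eq_bigr => x _.
  by rewrite alphaE mulrCA exp_complexM.
- by move=> x; exact: cvg_expi.
Qed.

Lemma norm_transition_eq1 (g : G) (t : R) :
  `|transition S g g t| = 1 <-> forall x, expi (t * (a 0 - a x)) = 1.
Proof.
have n0 : #|G|%:R != 0 :> R[i]%C.
  by rewrite pnatr_eq0 -lt0n; apply/card_gt0P; exists 0.
have -> : transition S g g t = #|G|%:R^-1 * \sum_x expi (t * a x).
  rewrite transitionE mulr_sumr; apply: eq_bigr => x _.
  by rewrite subrr cayley_charr0 mulr1.
rewrite normrM normfV normr_nat; split=> [h x|h].
  (* Equality in the triangle inequality: both sides are n. Unit terms must then all coincide. *)
  have : `|\sum_x expi (t * a x)| = \sum_x `|expi (t * a x)|.
    under [RHS]eq_bigr do rewrite norm_expi.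
    by rewrite sumr_const; apply: (mulfI (invr_neq0 n0)); rewrite h mulVf.
  case/normC_sum_eq1 => [y _|z _ zE]; first exact: norm_expi.
  by rewrite mulrBr expiB !zE // divff // -(zE x) // expi_eq0.
have -> : \sum_x expi (t * a x) = #|G|%:R * expi (t * a 0).
  rewrite mulr_natl -sumr_const; apply: eq_bigr => x _.
  by rewrite -[in RHS](subrK (t * a x) (t * a 0)) expiD -mulrBr h mul1r.
by rewrite normrM normr_nat norm_expi mulr1 mulVf.
Qed.

End Transition.

(** * The gcd of the gaps d - alpha_x *)

Section Eigengap.
Variables (R : realType) (G : finZmodType) (D : cyclic_decomposition G).
Variable S : {set G}.
Variable m : G -> int.
Hypothesis alphaE : forall x, cayley_eigenvalue R S D x = (m x)%:~R.

Lemma cayley_eigenvalue0 : cayley_eigenvalue R S D 0 = #|S|%:R.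
Proof.
rewrite -sumr_const; apply: eq_bigr => g _.
by rewrite cayley_charC cayley_charr0.
Qed.

(** The trivial character gives d = alpha_0, so each gap is an integer and the floor returns it
    unchanged. *)
Lemma eigengap_gcdE : eigengap_gcd R S D = \big[gcdn/0%N]_x `|(m 0 - m x)%R|%N.
Proof.
apply: eq_bigr => x _; rewrite -cayley_eigenvalue0 !alphaE -rmorphB /=.
by rewrite -(rmorph_int (real_complex R)) /= intrKfloor.
Qed.

Lemma eigengap_gcd_gt0 : cayley_simple S -> S != finset.set0 ->
  (0 < eigengap_gcd R S D)%N.
Proof.
(* If M = 0 then A = d I; but the diagonal of A is 0, so d = 0. *)
move=> hsimple S0; rewrite lt0n; apply: contraNneq S0 => M0.
have alpha_const x : cayley_eigenvalue R S D x = #|S|%:R.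
  have : (eigengap_gcd R S D %| `|(m 0 - m x)%R|)%N.
    by rewrite eigengap_gcdE; exact: (biggcdn_inf x).
  rewrite M0 dvd0n absz_eq0 subr_eq0 => /eqP m0x.
  by rewrite -cayley_eigenvalue0 !alphaE m0x.
pose i : 'I_#|G| := enum_rank 0.
have := adjacency_matrixX R D hsimple 1 i i; rewrite expr1 mxE /cayley_adj subrr.
rewrite (negbTE hsimple.1).
under eq_bigr do rewrite cayley_charr0 alpha_const expr1 mulr1.
rewrite sumr_const -[X in _ = X]mulr_natr mulrAC mulVf ?mul1r; last first.
  by rewrite pnatr_eq0 -lt0n; apply/card_gt0P; exists 0.
by move/eqP; rewrite eq_sym pnatr_eq0 cards_eq0.
Qed.

End Eigengap.

(** By Bezout a gcd is an integer combination, so the integer multiples of [p] persist at each gcd;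
    the empty gcd 0 gives the multiple 0. *)
Lemma mul_biggcdn_multiple (R : realFieldType) (I : finType) (c : I -> nat)
    (t p : R) :
  (forall x, exists k : int, t * (c x)%:R = p * k%:~R) ->
  exists k : int, t * (\big[gcdn/0%N]_x c x)%:R = p * k%:~R.
Proof.
move=> h.
apply: (big_ind (fun c : nat => exists k : int, t * c%:R = p * k%:~R))
  => [|y z [k yk] [l zl]|x _]; last exact: h.
  by exists 0; rewrite !mulr0.
have [u [v uv]] := Bezoutz y z; exists (u * k + v * l).
have -> : (gcdn y z)%:R = (gcdz y z)%:~R :> R by [].
rewrite -uv !intrD !intrM !mulrDr !(mulrCA _ u%:~R) !(mulrCA _ v%:~R).
by rewrite -!pmulrn yk zl.
Qed.

(** * Determination of the set of periods *)

Unset Implicit Arguments.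
Set Strict Implicit.
Set Printing Implicit Defensive.

Theorem theorem2p3 (R : realType) (G : finZmodType)
    (D : cyclic_decomposition G) (S : {set G})
    (hn : (2 <= #|G|)%N) (hS0 : S != finset.set0)
    (hsimple : cayley_simple S) (hconn : cayley_connected S)
    (hint : cayley_integral R S D) :
  (0 < eigengap_gcd R S D)%N /\
  forall g : G,
    periodic_at R S g /\
    periods S g =
      [set 2 * pi * l%:R / (eigengap_gcd R S D)%:R :> R
        | l in [set l : nat | (0 < l)%N]].
Proof.
have [m alphaE] := choice hint.
have M0 := eigengap_gcd_gt0 alphaE hsimple hS0; split=> // g.
have Mr0 : 0 < (eigengap_gcd R S D)%:R :> R by rewrite ltr0n.
have pi2 : 0 < 2 * pi :> R by rewrite mulr_gt0 ?pi_gt0.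
have alphaR x : cayley_eigenvalue R S D x = ((m x)%:~R : R)%:C%C.
  by rewrite alphaE (rmorph_int (real_complex R)).
have periodsE : periods S g = [set 2 * pi * l%:R / (eigengap_gcd R S D)%:R :> R
    | l in [set l : nat | (0 < l)%N]].
  apply/seteqP; split=> [t [t0]|_ [l l0 <-]].
    move=> /(norm_transition_eq1 hsimple alphaR) tE.
    have [x|k] := @mul_biggcdn_multiple _ _ (fun x => `|(m 0 - m x)%R|%N) t (2 * pi).
      have /expi_eq1[k] := tE x; rewrite -intrB.
      (* The gcd is taken over absolute values; a negative gap is absorbed by the sign of [k]. *)
      have [h|h] := ger0P (m 0 - m x) => tk.
        by exists k; rewrite -tk -[in RHS](gez0_abs h).
      exists (- k); rewrite mulrNz mulrN -tk -mulrN -mulrNz.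
      by rewrite -[in RHS](ltz0_abs h).
    rewrite -(eigengap_gcdE alphaE) => tk.
    (* From t M = 2 pi k with [t] positive; this makes [|k|] an admissible index l >= 1. *)
    have k0 : 0 < k.
      by rewrite -(ltr0z R) -(pmulr_rgt0 _ pi2) -tk mulr_gt0.
    exists `|k|%N; first by rewrite /= absz_gt0 gt_eqF.
    by apply: (canLR (mulfK (lt0r_neq0 Mr0))); rewrite tk -[in RHS](gtz0_abs k0).
  split; first by rewrite divr_gt0 // mulr_gt0 // ltr0n.
  apply/(norm_transition_eq1 hsimple alphaR) => x.
  (* Conversely M divides each gap, with quotient [q], so t times the gap is 2 pi l q. *)
  have /dvdzP[q qE] : ((eigengap_gcd R S D)%:Z %| (m 0 - m x)%R)%Z.
    by rewrite dvdzE /= (eigengap_gcdE alphaE); exact: (biggcdn_inf x).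
  have -> : 2 * pi * l%:R / (eigengap_gcd R S D)%:R * ((m 0)%:~R - (m x)%:~R)
      = 2 * pi * (l%:Z * q)%:~R :> R.
    rewrite -intrB qE !intrM -!pmulrn; field.
    by rewrite gt_eqF.
  exact: expi_2pi_int.
(* Periodicity is witnessed by the least period, l = 1. *)
split=> //; exists (2 * pi * 1%:R / (eigengap_gcd R S D)%:R).
by rewrite periodsE; exists 1%N.
Qed.
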